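(* Let $A$ be a real symmetric $n\times n$ matrix, $i\in[n]$, and $B$ a real symmetric $m\times m$ matrix. Then the direct sum $A\oplus B$ has the $i$-SNIP if and only if $A$ has the $i$-SNIP and $B$ is nonsingular.
   Context: A symmetric matrix $M$ has the $i$-SNIP if $X=O$ is the only real symmetric matrix $X$ (of the same size) with $M\circ X=O$, $I\circ X=O$ ($\circ$ the entrywise product) and $(MX)(i,:]=O$, where $(MX)(i,:]$ is $MX$ with row $i$ deleted. In $A\oplus B$ the index $i$ refers to the $i$-th row/column, lying in the $A$ block. *)

(* Defs.v *)
From HB Require Import structures.
From mathcomp Require Import all_boot all_order all_algebra.
From mathcomp Require Import reals.

Set Implicit Arguments.
Unset Strict Implicit.
Unset Printing Implicit Defensive.

Import Order.TTheory GRing.Theory Num.Theory.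
Local Open Scope ring_scope.

Definition hadamard (R : realType) (m n : nat) (A B : 'M[R]_(m, n)) :
  'M[R]_(m, n) := map2_mx *%R A B.

(* Only meant for symmetric M; symmetry of M is a separate hypothesis. *)
Definition SNIP (R : realType) (n : nat) (i : 'I_n) (M : 'M[R]_n) : Prop :=
  forall X : 'M[R]_n, X^T = X ->
    hadamard M X = 0 -> hadamard 1%:M X = 0 -> row' i (M *m X) = 0 -> X = 0.

Definition direct_sum (R : realType) (n m : nat) (A : 'M[R]_n) (B : 'M[R]_m) :
  'M[R]_(n + m) := block_mx A 0 0 B.

(* Main.v *)
Require Import Defs.
From HB Require Import structures.
From mathcomp Require Import all_boot all_order all_algebra.
From mathcomp Require Import reals.

Set Implicit Arguments.
Unset Strict Implicit.
Unset Printing Implicit Defensive.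

Import Order.TTheory GRing.Theory Num.Theory.
Local Open Scope ring_scope.

(** Write [X] in blocks [[P, Q], [Q^T, S]].  The lower rows of [(A (+) B) X] are
    [B Q^T] and [B S], so if [B] is invertible only [P] survives, and [P] is
    subject to the SNIP conditions for [A].  Conversely, there is always a
    nonzero [x] with [A x] supported at [i] (a kernel vector of [A], or
    [A^-1 e_i]); if [B y = 0] with [y != 0], then [P = 0], [S = 0], [Q = x y^T]
    violates the SNIP of [A (+) B]. *)

Lemma row'_eq0P (V : nmodType) (m n : nat) (i : 'I_m) (M : 'M[V]_(m, n)) :
  row' i M = 0 <-> forall j k, j != i -> M j k = 0.
Proof.
split=> [/matrixP M0 j k | M0].
  rewrite eq_sym => /unlift_some [l -> _].
  by have := M0 l k; rewrite !mxE.
by apply/matrixP=> j k; rewrite !mxE M0 // eq_sym neq_lift.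
Qed.

(** The deleted row meets only the upper blocks, so the lower ones must vanish in full. *)
Lemma row'_lshift_block_eq0 (V : nmodType) (m1 m2 n1 n2 : nat) (i : 'I_m1)
    (P : 'M[V]_(m1, n1)) (Q : 'M[V]_(m1, n2))
    (S : 'M[V]_(m2, n1)) (T : 'M[V]_(m2, n2)) :
  row' (lshift m2 i) (block_mx P Q S T) = 0 <->
  [/\ row' i P = 0, row' i Q = 0, S = 0 & T = 0].
Proof.
split=> [/row'_eq0P M0 | [/row'_eq0P P0 /row'_eq0P Q0 -> ->]].
  split; [apply/row'_eq0P=> j k ji | apply/row'_eq0P=> j k ji
         | apply/matrixP=> j k | apply/matrixP=> j k].
  - by rewrite -(block_mxEul P Q S T) M0 // (inj_eq (@lshift_inj _ _)).
  - by rewrite -(block_mxEur P Q S T) M0 // (inj_eq (@lshift_inj _ _)).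
  - by rewrite -(block_mxEdl P Q S T) M0 ?mxE // eq_rlshift.
  - by rewrite -(block_mxEdr P Q S T) M0 ?mxE // eq_rlshift.
apply/row'_eq0P=> j k.
case: (split_ordP j) => j' ->; case: (split_ordP k) => k' ->;
  rewrite ?block_mxEul ?block_mxEur ?block_mxEdl ?block_mxEdr ?mxE //.
- by rewrite (inj_eq (@lshift_inj _ _)); apply: P0.
- by rewrite (inj_eq (@lshift_inj _ _)); apply: Q0.
Qed.

Lemma hadamard_direct_sum (R : realType) (n m : nat) (A : 'M[R]_n) (B : 'M[R]_m)
    (P : 'M[R]_n) (Q : 'M[R]_(n, m)) (S : 'M[R]_(m, n)) (T : 'M[R]_m) :
  hadamard (direct_sum A B) (block_mx P Q S T) =
  direct_sum (hadamard A P) (hadamard B T).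
Proof.
apply/matrixP=> j k.
case: (split_ordP j) => j' ->; case: (split_ordP k) => k' ->;
  by rewrite mxE ?block_mxEul ?block_mxEur ?block_mxEdl ?block_mxEdr !mxE ?mul0r.
Qed.

Lemma hadamard_mx0 (R : realType) (m n : nat) (A : 'M[R]_(m, n)) :
  hadamard A 0 = 0.
Proof. by apply/matrixP=> j k; rewrite !mxE mulr0. Qed.

Lemma mul_direct_sum_block (R : realType) (n m : nat) (A : 'M[R]_n)
    (B : 'M[R]_m) (P : 'M[R]_n) (Q : 'M[R]_(n, m)) (S : 'M[R]_(m, n))
    (T : 'M[R]_m) :
  direct_sum A B *m block_mx P Q S T =
  block_mx (A *m P) (A *m Q) (B *m S) (B *m T).
Proof. by rewrite mulmx_block !mul0mx !addr0 !add0r. Qed.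

(** Lets [hadamard_direct_sum] treat the zero-diagonal condition exactly like the condition on [A]
    and [B]. *)
Lemma direct_sum1 (R : realType) (n m : nat) :
  1%:M = direct_sum 1%:M 1%:M :> 'M[R]_(n + m).
Proof. exact: scalar_mx_block. Qed.

(** Both Hadamard conditions involve matrices with zero off-diagonal blocks, so they leave [Q] free;
    only the product condition constrains it. *)
Lemma SNIP_direct_sumP (R : realType) (n m : nat) (i : 'I_n) (A : 'M[R]_n)
    (B : 'M[R]_m) :
  SNIP (lshift m i) (direct_sum A B) <->
  forall P Q S, P^T = P -> S^T = S ->
    hadamard A P = 0 -> hadamard B S = 0 ->
    hadamard 1%:M P = 0 -> hadamard 1%:M S = 0 ->
    row' i (A *m P) = 0 -> row' i (A *m Q) = 0 ->
    B *m Q^T = 0 -> B *m S = 0 -> [/\ P = 0, Q = 0 & S = 0].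
Proof.
split=> [sAB P Q S symP symS AP BS IP IS rP rQ BQ BS0 | sAB X].
  have : block_mx P Q Q^T S = 0.
    apply: sAB.
    - by rewrite tr_block_mx trmxK symP symS.
    - by rewrite hadamard_direct_sum AP BS /direct_sum block_mx0.
    - by rewrite direct_sum1 hadamard_direct_sum IP IS /direct_sum block_mx0.
    - by rewrite mul_direct_sum_block; apply/row'_lshift_block_eq0.
  by rewrite -block_mx0 => /eq_block_mx[-> -> _ ->].
rewrite -[X]submxK; move: (ulsubmx X) (ursubmx X) (dlsubmx X) (drsubmx X).
(* Symmetry of [X] forces the lower left block [Q'] to be [Q^T]. *)
move=> P Q Q' S; rewrite tr_block_mx => /eq_block_mx[symP _ <- symS].
rewrite direct_sum1 !hadamard_direct_sum mul_direct_sum_block /direct_sum.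
rewrite -block_mx0 => /eq_block_mx[AP _ _ BS] /eq_block_mx[IP _ _ IS].
case/row'_lshift_block_eq0=> rP rQ BQ BS0.
by have [-> -> ->] := sAB P Q S symP symS AP BS IP IS rP rQ BQ BS0; rewrite trmx0.
Qed.

Lemma unitmxPn (F : fieldType) (n : nat) (A : 'M[F]_n) :
  A \notin unitmx -> exists2 x : 'cV[F]_n, x != 0 & A *m x = 0.
Proof.
rewrite -unitmx_tr -row_free_unit -kermx_eq0 => kA.
(* [kermx] is a left kernel, spanned by rows; passing to [A^T] turns it into the right kernel of
   [A]. *)
exists (nz_row (kermx A^T))^T; first by rewrite trmx_eq0 nz_row_eq0.
apply: trmx_inj; rewrite trmx_mul trmxK trmx0.
by apply/sub_kermxP; apply: nz_row_sub.
Qed.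

Lemma exists_mulmx_row'0 (F : fieldType) (n : nat) (i : 'I_n) (A : 'M[F]_n) :
  exists2 x : 'cV[F]_n, x != 0 & row' i (A *m x) = 0.
Proof.
have [uA | /unitmxPn[x x0 Ax]] := boolP (A \in unitmx); last first.
  by exists x; rewrite // Ax; apply/row'_eq0P=> j k _; rewrite mxE.
exists (invmx A *m delta_mx i 0).
  (* Were this vector zero, multiplying by [A] would give [delta_mx i 0 = 0], whose entry at [i]
     reads 1 = 0. *)
  apply: contraTneq (oner_neq0 F) => /(congr1 (mulmx A)).
  rewrite mulKVmx // mulmx0 => /matrixP/(_ i 0).
  by rewrite negbK !mxE !eqxx => /eqP.
by rewrite mulKVmx //; apply/row'_eq0P=> j k ji; rewrite mxE (negPf ji).
Qed.

(** The entry at a nonzero [x j] and a nonzero [y k] is their product, nonzero in a field. *)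
Lemma mul_col_row_neq0 (F : fieldType) (n m : nat) (x : 'cV[F]_n)
    (y : 'cV[F]_m) : x != 0 -> y != 0 -> x *m y^T != 0.
Proof.
move=> /cV0Pn[j xj] /cV0Pn[k yk]; apply/matrix0Pn; exists j, k.
by rewrite mxE big_ord1 [y^T _ _]mxE mulf_neq0.
Qed.

Theorem proposition3p5 (R : realType) (n m : nat) (i : 'I_n)
    (A : 'M[R]_n) (B : 'M[R]_m) (symA : A^T = A) (symB : B^T = B) :
  SNIP (lshift m i) (direct_sum A B) <-> SNIP i A /\ B \in unitmx.
Proof.
have row'0 k : row' i (0 : 'M[R]_(n, k)) = 0.
  by apply/row'_eq0P=> j l _; rewrite mxE.
split=> [/SNIP_direct_sumP sAB | [sA uB]]; first split.
(* Pad [P] with zero blocks to test the SNIP of the direct sum. *)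
- move=> P symP AP IP rP.
  by have [] := sAB P 0 0; rewrite ?trmx0 ?mulmx0 ?hadamard_mx0.
- apply/negPn/negP=> /unitmxPn[y y0 By].
  have [x x0 Ax] := exists_mulmx_row'0 i A.
  have [] := sAB 0 (x *m y^T) 0; rewrite ?trmx0 ?mulmx0 ?hadamard_mx0 //.
  + apply/row'_eq0P=> j k ji; rewrite mulmxA mxE big_ord1.
    by move/row'_eq0P: Ax => ->; rewrite ?mul0r.
  + by rewrite trmx_mul trmxK mulmxA By mul0mx.
  + by move=> _ xy0; have := mul_col_row_neq0 x0 y0; rewrite xy0 eqxx.
apply/SNIP_direct_sumP=> P Q S symP symS AP BS IP IS rP rQ BQ BS0.
split; first exact: sA.
  (* Cancel [B] in [B *m Q^T = 0], and likewise in [B *m S = 0] below. *)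
  by apply: trmx_inj; rewrite -(mulKmx uB Q^T) BQ mulmx0 trmx0.
by rewrite -(mulKmx uB S) BS0 mulmx0.
Qed.
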